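(* Assume that $\mathcal{B}\neq\emptyset$, fix an element $(\mathbf{b}_\tau)_{\tau\in\tilde{\mathcal{F}}}\in\mathcal{B}$, and let $\omega(S)$ be the associated subset of $\mathbb{Z}^d$. Then $$D(\omega(S))=D(S)^\ast,\qquad\text{where } D(S)^\ast=\{P^\ast: P\in D(S)\}.$$
   Context: $K$ is an algebraically closed field of characteristic zero. $A\subset\mathbb{Z}^d$ is a finite set with $\mathbb{Z}A=\mathbb{Z}^d$ and with strongly convex cone $\mathbb{R}_{\geq 0}A$; $\mathbb{N}A$ is the monoid generated by $A$. $\mathcal{F}$ is the set of facets of $\mathbb{R}_{\geq 0}A$. For $\sigma\in\mathcal{F}$, $F_\sigma$ is the unique linear form on $\mathbb{R}^d$ with $F_\sigma(\mathbb{R}_{\geq 0}A)\geq 0$, $F_\sigma(\sigma)=0$, $F_\sigma(\mathbb{Z}^d)=\mathbb{Z}$. For a face $\tau$, $\mathbb{Z}(A\cap\tau)$ is the group generated by $A\cap\tau$, and $K\tau\subseteq K^d$ is the $K$-linear span of $A\cap\tau$. $\tau\succeq\tau'$ means that $\tau'$ is a face of $\tau$. $T\subseteq\mathbb{Z}^d$ is an $\mathbb{N}A$-set if $T+\mathbb{N}A\subseteq T$; it is finitely generated if $T=G+\mathbb{N}A$ with $G$ finite; it is scored if $T=\bigcap_{\sigma\in\mathcal{F}}\{\mathbf{a}\in\mathbb{Z}^d:F_\sigma(\mathbf{a})\in F_\sigma(T)\}$. Standing setting: $S_c$ is a finitely generated scored $\mathbb{N}A$-set, $\mathbf{b}_1,\ldots,\mathbf{b}_m\in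 S_c$, $\tau_1,\ldots,\tau_m$ are faces of $\mathbb{R}_{\geq 0}A$, $S=S_c\setminus\bigcup_{i=1}^m(\mathbf{b}_i+\mathbb{Z}(A\cap\tau_i))$, this expression is irredundant (no $\mathbf{b}_i+\mathbb{Z}(A\cap\tau_i)$ can be omitted), $F_\sigma(S)=F_\sigma(S_c)$ for all $\sigma\in\mathcal{F}$, and $S$ is an $\mathbb{N}A$-set. $\tilde{\mathcal{F}}=\mathcal{F}\cup\{\tau_i: i=1,\ldots,m\}$. $\mathcal{B}$ is the set of families $(\mathbf{b}_\tau)_{\tau\in\tilde{\mathcal{F}}}$ with $\mathbf{b}_\tau\in (K\tau\cap\mathbb{Z}^d)/\mathbb{Z}(A\cap\tau)$ for all $\tau\in\tilde{\mathcal{F}}$ such that for all $i$ and all $\tau\in\tilde{\mathcal{F}}$ with $\tau\succeq\tau_i$ there exists $j$ with $\tau_j=\tau$ and $\mathbf{b}_i+\mathbf{b}_{\tau_i}=\mathbf{b}_j+\mathbf{b}_{\tau_j}$ mod $\mathbb{Z}(A\cap\tau)$. For a fixed $(\mathbf{b}_\tau)\in\mathcal{B}$, $$\omega(S)=\{\mathbf{a}\in\mathbb{Z}^d: -\mathbf{a}-\mathbf{b}_\tau\notin S+\mathbb{Z}(A\cap\tau)\text{ for each }\tau\in\tilde{\mathcal{F}}\}.$$ $D(\mathbb{Z}^d)=K[t_1^{\pm1},\ldots,t_d^{\pm1}]\langle\partial_1,\ldots,\partial_d\rangle$ acts on $K[t_1^{\pm1},\ldots,t_d^{\pm1}]$;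 $s_j=t_j\partial_j$. For $T\subseteq\mathbb{Z}^d$, $K[T]=\bigoplus_{\mathbf{a}\in T}Kt^{\mathbf{a}}$ and $D(T)=\{P\in D(\mathbb{Z}^d):P(K[T])\subseteq K[T]\}$. Every $P\in D(\mathbb{Z}^d)$ is uniquely a finite sum $P=\sum_{\mathbf{a}}t^{\mathbf{a}}f_{\mathbf{a}}(s)$ with $f_{\mathbf{a}}\in K[s_1,\ldots,s_d]$, and its formal adjoint is $P^\ast=\sum_{\mathbf{a}}f_{\mathbf{a}}(-s)t^{\mathbf{a}}$. *)

(* Defs.v *)
From HB Require Import structures.
From mathcomp Require Import all_boot all_order all_algebra finmap.
From mathcomp Require Import monalg.
From mathcomp Require Import mpoly.
From mathcomp Require Import boolp classical_sets functions cardinality reals.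

Set Implicit Arguments.
Unset Strict Implicit.
Unset Printing Implicit Defensive.

Import Order.TTheory GRing.Theory Num.Theory.

Local Open Scope classical_set_scope.
Local Open Scope ring_scope.

(* Z^d is 'rV[int]_d; R^d and K^d are 'rV[R]_d and 'rV[K]_d, and [of_int]
   embeds the lattice in either of them. *)
Definition of_int (L : pzRingType) (d : nat) (a : 'rV[int]_d) : 'rV[L]_d :=
  map_mx intr a.

Definition minkowski (V : zmodType) (X Y : set V) : set V :=
  [set x + y | x in X & y in Y].

Definition translate (V : zmodType) (x : V) (Y : set V) : set V :=
  [set x + y | y in Y].

Section Spans.
Variable d : nat.
Implicit Types B : set 'rV[int]_d.

Definition Nspan B : set 'rV[int]_d :=
  [set x | exists2 s : seq 'rV[int]_d,
     (forall a, a \in s -> B a) & x = \sum_(a <- s) a].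

Definition Zspan B : set 'rV[int]_d :=
  [set x - y | x in Nspan B & y in Nspan B].

Definition Lspan (L : fieldType) B : set 'rV[L]_d :=
  [set x | exists (s : seq 'rV[int]_d) (c : 'rV[int]_d -> L),
     (forall a, a \in s -> B a) /\ x = \sum_(a <- s) c a *: of_int L a].

End Spans.
Arguments Lspan {d} L B _.

Section Cones.
Variables (R : realType) (d : nat).
Implicit Types (A : set 'rV[int]_d) (C tau sigma : set 'rV[R]_d).

Definition cone A : set 'rV[R]_d :=
  [set x | exists (s : seq 'rV[int]_d) (c : 'rV[int]_d -> R),
     [/\ forall a, a \in s -> A a,
         forall a, 0 <= c a
       & x = \sum_(a <- s) c a *: of_int R a] ].

Definition strongly_convex C : Prop := forall x, C x -> C (- x) -> x = 0.

(* C itself is a face of C (take phi = 0); the empty set is not a face of a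
   cone. *)
Definition face C tau : Prop :=
  exists phi : {scalar 'rV[R]_d},
    (forall x, C x -> 0 <= phi x) /\ tau = [set x | C x /\ phi x = 0].

Definition facet C sigma : Prop :=
  [/\ face C sigma, sigma <> C
    & forall tau, face C tau -> sigma `<=` tau -> tau = sigma \/ tau = C].

Definition primitive_form C sigma (F : {scalar 'rV[R]_d}) : Prop :=
  [/\ forall x, C x -> 0 <= F x,
      forall x, sigma x -> F x = 0
    & [set F (of_int R a) | a in [set: 'rV[int]_d]]
      = [set n%:~R | n in [set: int] ] ].

Definition on_face A tau : set 'rV[int]_d := [set a | A a /\ tau (of_int R a)].

Definition lattice_values (F : {scalar 'rV[R]_d}) (T : set 'rV[int]_d) : set R :=
  [set F (of_int R a) | a in T].

(* The family F : set 'rV[R]_d -> {scalar 'rV[R]_d} sends each facet sigma to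
   the linear form F_sigma; its values elsewhere are not used. *)
Definition scored A (F : set 'rV[R]_d -> {scalar 'rV[R]_d})
    (T : set 'rV[int]_d) : Prop :=
  T = [set a | forall sigma, facet (cone A) sigma ->
                 lattice_values (F sigma) T (F sigma (of_int R a))].

End Cones.

Definition NA_set d (A T : set 'rV[int]_d) : Prop :=
  minkowski T (Nspan A) `<=` T.

Definition fin_generated d (A T : set 'rV[int]_d) : Prop :=
  exists2 G : set 'rV[int]_d, finite_set G & T = minkowski G (Nspan A).

Section Duality.
Variables (R : realType) (d m : nat) (A : set 'rV[int]_d).
Variables (b : 'I_m -> 'rV[int]_d) (tau : 'I_m -> set 'rV[R]_d).

Definition facets_and_taus : set (set 'rV[R]_d) :=
  [set rho | facet (cone A) rho \/ exists i, tau i = rho].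

(* An element of (K rho \cap Z^d) / Z(A \cap rho) is given by a representative
   beta rho; every condition below depends on its class only. *)
Definition compatible_family (K : fieldType)
    (beta : set 'rV[R]_d -> 'rV[int]_d) : Prop :=
  (forall rho, facets_and_taus rho ->
     Lspan K (on_face A rho) (of_int K (beta rho))) /\
  (forall (i : 'I_m) rho, facets_and_taus rho -> face rho (tau i) ->
     exists j : 'I_m, tau j = rho /\
       Zspan (on_face A rho)
         ((b i + beta (tau i)) - (b j + beta (tau j)))).

Definition omega (beta : set 'rV[R]_d -> 'rV[int]_d) (S : set 'rV[int]_d) :
    set 'rV[int]_d :=
  [set a | forall rho, facets_and_taus rho ->
     ~ minkowski S (Zspan (on_face A rho)) (- a - beta rho)].

End Duality.

Section DifferentialOperators.
Variables (K : fieldType) (d : nat).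

(* The Laurent polynomials K[t_1^{+-1}, ..., t_d^{+-1}], as finitely supported
   functions on Z^d; << a >> is the monomial t^a. The library has no ring
   structure on {malg K[G]} for a group G, so products by monomials are
   defined on the monomial basis. *)
Local Notation Laurent := {malg K['rV[int]_d]}.

Definition lin_extend (u : 'rV[int]_d -> Laurent) (p : Laurent) : Laurent :=
  \sum_(a <- monalg.msupp p) monalg.mcoeff a p *: u a.

Definition tmul (a : 'rV[int]_d) : Laurent -> Laurent :=
  lin_extend (fun c => << a + c >>).

Definition partial (i : 'I_d) : Laurent -> Laurent :=
  lin_extend (fun c => << (c 0 i)%:~R *g c - delta_mx 0 i >>).

(* D(Z^d), identified with its (faithful, as char K = 0) image in
   End_K(Laurent): the K-subalgebra generated by the t^a and the partial_i. *)
Inductive diff_op : (Laurent -> Laurent) -> Prop :=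
| diff_op_tmul a : diff_op (tmul a)
| diff_op_partial i : diff_op (partial i)
| diff_op_scale (c : K) P : diff_op P -> diff_op (fun p => c *: P p)
| diff_op_add P Q : diff_op P -> diff_op Q -> diff_op (fun p => P p + Q p)
| diff_op_comp P Q : diff_op P -> diff_op Q -> diff_op (P \o Q).

Definition supported_in (T : set 'rV[int]_d) : set Laurent :=
  [set p | forall a, a \in monalg.msupp p -> T a].

Definition diff_ops (T : set 'rV[int]_d) : set (Laurent -> Laurent) :=
  [set P | diff_op P /\ forall p, supported_in T p -> supported_in T (P p)].

Definition euler (i : 'I_d) : Laurent -> Laurent :=
  tmul (delta_mx 0 i) \o partial i.

(* f(theta_1, ..., theta_d), for pairwise commuting operators theta_i. The type
   is written mpoly d K because both monalg and mpoly declare {mpoly K[d]}. *)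
Definition mpoly_op (theta : 'I_d -> Laurent -> Laurent) (f : mpoly d K)
    (p : Laurent) : Laurent :=
  \sum_(k <- msupp f) f@_k *:
    (\big[(fun P Q => P \o Q)/id]_(i < d) iter (k i) (theta i)) p.

(* Q = P^*: for the expansion P = \sum_a t^a f_a(s), Q = \sum_a f_a(-s) t^a. *)
Definition formal_adjoint (P Q : Laurent -> Laurent) : Prop :=
  exists (E : {fset 'rV[int]_d}) (f : 'rV[int]_d -> mpoly d K),
    (P = fun p => \sum_(a <- E) tmul a (mpoly_op euler (f a) p)) /\
    (Q = fun p =>
       \sum_(a <- E) mpoly_op (fun i q => - euler i q) (f a) (tmul a p)).

Definition adjoints (X : set (Laurent -> Laurent)) : set (Laurent -> Laurent) :=
  [set Q | exists2 P, X P & formal_adjoint P Q].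

End DifferentialOperators.
Arguments diff_ops K {d} T _.

(* Main.v *)
Require Import Defs.
From HB Require Import structures.
From mathcomp Require Import all_boot all_order all_algebra finmap.
From mathcomp Require Import monalg.
From mathcomp Require Import mpoly.
From mathcomp Require Import ring.
From mathcomp Require Import boolp classical_sets functions cardinality reals.

Set Implicit Arguments.
Unset Strict Implicit.
Unset Printing Implicit Defensive.

Import Order.TTheory GRing.Theory Num.Theory.
Local Open Scope classical_set_scope.
Local Open Scope ring_scope.

(** A differential operator is known through its action on monomials: with
    [P = sum_a t^a f_a(s)] one has [P t^c = sum_a f_a(c) t^(a+c)].  Hence [P]
    preserves [K[S]] exactly when every [f_a] vanishes on the exit set
    [{c in S : a + c notin S}], while
    [P^* t^c = sum_a f_a(-(a+c)) t^(a+c)] preserves [K[omega(S)]] exactly when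
    every [f_a] vanishes on the exit set of [W], the complement of
    [-omega(S)] ([diff_ops_eq_adjoints]).  By definition [W] is the union of
    the translated localizations [b_tau + S + Z(A cap tau)].  So it suffices
    that a polynomial vanishes on the exit set of [S] for [a] iff it vanishes
    on that of [W] ([vanish_exit_sets]).

    Both implications rest on one density principle ([vanish_Lspan]): a
    polynomial vanishing on [y + N(B)], or on [y - N(B)], vanishes on the whole
    affine space [y + KB].  As the shifts [b_tau] lie in [K tau], they
    are invisible to it.

    From [S] to [W]: if [x] in [b_tau + S + Z(A cap tau)] leaves [W] under [a],
    then, modulo [K tau], [x] is a point [y] of [S] such that all of
    [y + N(A cap tau)] leaves [S] under [a] ([vanish_on_localization]).

    From [W] to [S]: let [c] in [S] with [a + c] not in [S].  Either
    [F_sigma(a + c)] is not a value of [F_sigma] on [S] for some facet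
    [sigma], or [a + c] lies in some [b_i + Z(A cap tau_i)]; let [sigma] also
    denote [tau_i] in the second case.  The points [c + b_sigma - z], with [z]
    deep in [N(A cap sigma)], belong to [W], and
    [a + c + b_sigma - z] misses every piece [b_rho + S + Z(A cap rho)]
    ([exit_face]).  If [rho] does not contain [sigma], a form exposing [rho] is
    bounded below on that piece, but unbounded below along [-N(A cap sigma)]
    ([escape_localization]); if it does, the piece is missed because of the
    facet value, or because compatibility of the family [(b_tau)] identifies
    the class [b_i + b_(tau_i)] with a removed class [b_j + b_rho]. *)

(** * Spans of lattice vectors *)

Section Lattice.
Variables (d : nat).
Implicit Types (A B S T : set 'rV[int]_d) (a c x y z : 'rV[int]_d).

Lemma of_intD (L : pzRingType) a c : of_int L (a + c) = of_int L a + of_int L c.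
Proof. exact: raddfD. Qed.

Lemma of_intB (L : pzRingType) a c : of_int L (a - c) = of_int L a - of_int L c.
Proof. exact: raddfB. Qed.

Lemma of_int_sum (L : pzRingType) (s : seq 'rV[int]_d) :
  of_int L (\sum_(a <- s) a) = \sum_(a <- s) of_int L a.
Proof. exact: raddf_sum. Qed.

Lemma Nspan0 B : Nspan B 0.
Proof. by exists [::]; rewrite ?big_nil. Qed.

Lemma NspanD B x y : Nspan B x -> Nspan B y -> Nspan B (x + y).
Proof.
move=> [s Bs ->] [s' Bs' ->]; exists (s ++ s'); last by rewrite big_cat.
by move=> a; rewrite mem_cat => /orP[/Bs | /Bs'].
Qed.

Lemma NspanMn B a n : B a -> Nspan B (a *+ n).
Proof.
move=> Ba; exists (nseq n a); first by move=> c /nseqP[-> _].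
by rewrite big_nseq -Monoid.iteropE.
Qed.

Lemma Nspan_sub A B x : B `<=` A -> Nspan B x -> Nspan A x.
Proof. by move=> BA [s Bs ->]; exists s => // a /Bs /BA. Qed.

Lemma Zspan_sub A B x : B `<=` A -> Zspan B x -> Zspan A x.
Proof.
by move=> BA [p Bp [q Bq <-]]; exists p; [exact: Nspan_sub Bp|];
  exists q => //; exact: Nspan_sub Bq.
Qed.

Lemma ZspanN B z : Nspan B z -> Zspan B (- z).
Proof. by move=> Bz; exists 0; [exact: Nspan0|]; exists z; rewrite ?sub0r. Qed.

Lemma ZspanD B x y : Zspan B x -> Zspan B y -> Zspan B (x + y).
Proof.
move=> [p Bp [q Bq <-]] [p' Bp' [q' Bq' <-]].
exists (p + p'); first exact: NspanD.
by exists (q + q'); [exact: NspanD | rewrite opprD addrACA].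
Qed.

Lemma ZspanB B x y : Zspan B x -> Zspan B y -> Zspan B (x - y).
Proof.
move=> Bx [p Bp [q Bq <-]]; apply: ZspanD => //.
by exists q => //; exists p => //; rewrite opprB.
Qed.

Lemma NA_set_localization A B S :
  NA_set A S -> NA_set A (minkowski S (Zspan B)).
Proof.
move=> NAS _ [_ [s Ss [w Bw <-]] [z Az <-]].
exists (s + z); first by apply: NAS; exists s => //; exists z.
by exists w => //; rewrite addrAC.
Qed.

Lemma NA_setD A T x z : NA_set A T -> T x -> Nspan A z -> T (x + z).
Proof. by move=> NAT Tx Az; apply: NAT; exists x => //; exists z. Qed.

(** The complement of an [NA]-set is stable under subtraction of [N(A)], so the
    sum of the individual shifts works for all sets of a finite family at
    once. *)
Lemma uniform_shift (I : choiceType) (X : set I) (T : I -> set 'rV[int]_d)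
    A B y :
  finite_set X -> B `<=` A -> (forall i, NA_set A (T i)) ->
  (forall i, X i -> exists2 z, Nspan B z & ~ T i (y - z)) ->
  exists2 z, Nspan B z & forall i, X i -> ~ T i (y - z).
Proof.
move=> /finite_seqP[r ->] BA NAT; elim: r => [|i r IHr] out.
  by exists 0; [exact: Nspan0|].
have [j rj|z Bz outz] := IHr; first by apply: out; rewrite /= in_cons rj orbT.
have [|z' Bz' outz'] := out i; first by rewrite /= in_cons eqxx.
exists (z + z'); first exact: NspanD.
move=> j; rewrite /= in_cons => /orP[/eqP -> | rj] Tj.
  apply: outz'; have := NA_setD (NAT i) Tj (Nspan_sub BA Bz).
  by rewrite opprD addrA addrAC subrK.
apply: (outz j rj); have := NA_setD (NAT j) Tj (Nspan_sub BA Bz').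
by rewrite opprD addrA subrK.
Qed.

End Lattice.

Lemma sum_by_key (V : nmodType) (I T : eqType) (key : T -> I) (D : seq I)
    (s : seq T) (G : T -> V) :
  uniq D -> {subset [seq key t | t <- s] <= D} ->
  \sum_(a <- D) \sum_(t <- s | key t == a) G t = \sum_(t <- s) G t.
Proof.
move=> uD sD; rewrite (exchange_big_dep xpredT) //= big_seq [RHS]big_seq.
apply: eq_bigr => t ts.
rewrite (eq_bigl (pred1 (key t))) => [|a]; last exact: eq_sym.
rewrite -big_filter filter_pred1_uniq ?big_seq1 //.
exact/sD/map_f.
Qed.

(** * Zariski density of translates of a monoid in translates of its span *)

Section Density.
Variables (K : fieldType) (d : nat).
Hypothesis charK0 : [pchar K] =i pred0.
Implicit Types (f : mpoly d K) (B : set 'rV[int]_d) (v : 'rV[K]_d).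

Definition at_lattice f (c : 'rV[int]_d) : K := f.@[fun i => (c 0 i)%:~R].

(** Lists of coefficient-vector pairs make closure of the span under addition
    immediate: the coefficients in [Lspan] form a function of the vector, which
    cannot differ between two concatenated lists. *)
Lemma Lspan_pairs B v : Lspan K B v <->
  exists2 s : seq (K * 'rV[int]_d),
    (forall t, t \in s -> B t.2) & v = \sum_(t <- s) t.1 *: of_int K t.2.
Proof.
split=> [[s [c [Bs ->]]] | [s Bs ->]].
  exists [seq (c a, a) | a <- s]; last by rewrite big_map.
  by move=> _ /mapP[a /Bs Ba ->].
exists (undup (unzip2 s)), (fun a => \sum_(t <- s | t.2 == a) t.1); split.
  by move=> a; rewrite mem_undup => /mapP[t /Bs Bt ->].
rewrite -(@sum_by_key _ _ _ snd (undup (unzip2 s))) ?undup_uniq //; last first.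
  by move=> a; rewrite mem_undup.
apply: eq_bigr => a _; rewrite scaler_suml.
by apply: eq_bigr => t /eqP ->.
Qed.

Lemma LspanB B u v : Lspan K B u -> Lspan K B v -> Lspan K B (u - v).
Proof.
move=> /Lspan_pairs[s Bs ->] /Lspan_pairs[s' Bs' ->]; apply/Lspan_pairs.
exists (s ++ [seq (- t.1, t.2) | t <- s']).
  by move=> t; rewrite mem_cat => /orP[/Bs // | /mapP[t' /Bs' Bt' ->]].
rewrite big_cat big_map -sumrN; congr (_ + _).
by apply: eq_bigr => t _; rewrite scaleNr.
Qed.

Lemma Lspan_Nspan B z : Nspan B z -> Lspan K B (of_int K z).
Proof.
move=> [s Bs ->]; exists s, (fun=> 1); split=> //.
by rewrite of_int_sum; apply: eq_bigr => a _; rewrite scale1r.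
Qed.

(** The restriction of [f] to a line is a polynomial in one variable, which has
    infinitely many roots since [K] has characteristic zero. *)
Lemma vanish_line f (y v : 'rV[K]_d) (e : K) : e != 0 ->
  (forall n : nat, f.@[(y + (e * n%:R) *: v) 0] = 0) ->
  forall k : K, f.@[(y + k *: v) 0] = 0.
Proof.
move=> e0 f0.
pose p : {poly K} := mmap polyC (fun i => (y 0 i)%:P + (v 0 i)%:P * 'X) f.
have pE k : p.[k] = f.@[(y + k *: v) 0].
  rewrite /p /mmap mevalE horner_sum; apply: eq_bigr => m _.
  rewrite hornerM hornerC /mmap1 horner_prod; congr (_ * _).
  apply: eq_bigr => i _.
  by rewrite horner_exp hornerD hornerM !hornerC hornerX !mxE (mulrC k).
suff p0 : p = 0 by move=> k; rewrite -pE p0 horner0.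
apply/eqP/negPn/negP => p_n0; pose r := [seq e * n%:R | n <- iota 0 (size p)].
suff : (size r < size p)%N by rewrite size_map size_iota ltnn.
apply: max_poly_roots p_n0 _ _.
  by apply/allP => _ /mapP[n _ ->]; rewrite rootE pE f0.
rewrite map_inj_uniq ?iota_uniq // => i j /(mulfI e0).
wlog le_ij : i j / (i <= j)%N => [sym|].
  by case/orP: (leq_total i j) => le ij; [|symmetry]; exact: sym.
move=> /eqP; rewrite eq_sym -subr_eq0 -natrB // (pcharf0P K).1 // subn_eq0.
by move=> le_ji; apply/eqP; rewrite eqn_leq le_ij.
Qed.

Lemma at_latticeE f c : at_lattice f c = f.@[of_int K c 0].
Proof. by apply: meval_eq => i; rewrite mxE. Qed.

(** The coordinates along the generators are freed one at a time, each by
    [vanish_line]; the quantification over [z] in [Nspan B] leaves room to move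
    along the next generator.  Both signs of [k] serve: [S] is stable under
    adding [N(A)], the complement of [W] under subtracting it. *)
Lemma vanish_Lspan f B (y x : 'rV[int]_d) (k : int) :
  k%:~R != 0 :> K ->
  (forall z, Nspan B z -> at_lattice f (y + k *: z) = 0) ->
  Lspan K B (of_int K (x - y)) -> at_lattice f x = 0.
Proof.
move=> k0 f0 /Lspan_pairs[s Bs xy].
have -> : at_lattice f x =
    f.@[(of_int K (y + k *: 0) + \sum_(t <- s) t.1 *: of_int K t.2) 0].
  by rewrite -xy -of_intD scaler0 addr0 addrC subrK at_latticeE.
elim: s {x xy} Bs 0 (Nspan0 B) => [|t s IHs] Bs z Bz.
  by rewrite big_nil addr0 -at_latticeE f0.
rewrite big_cons addrCA [t.1 *: _ + _]addrC; apply: (vanish_line k0) => n.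
have := IHs _ (z + t.2 *+ n) _.
have -> : of_int K (y + k *: (z + t.2 *+ n)) =
    of_int K (y + k *: z) + (k%:~R * n%:R) *: of_int K t.2.
  apply/rowP => i.
  rewrite !mxE mulmxnE mulrDr addrA intrD; congr (_ + _).
  by rewrite intrM rmorphMn /= -mulrA mulr_natl.
rewrite addrAC; apply.
  by move=> t' st'; apply: Bs; rewrite in_cons st' orbT.
by apply: NspanD => //; apply: NspanMn; apply: Bs; rewrite in_cons eqxx.
Qed.

End Density.

(** * Faces of a finitely generated cone *)

Section Faces.
Variables (R : realType) (d : nat).
Implicit Types (A G S : set 'rV[int]_d) (tau rho sigma C : set 'rV[R]_d).

Lemma face_sub C tau : face C tau -> tau `<=` C.
Proof. by move=> [phi [_ ->]] x []. Qed.

Lemma face_of_subface C tau rho :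
  face C tau -> face C rho -> tau `<=` rho -> face rho tau.
Proof.
move=> [phi [phi_ge0 tauE]] fr tr; exists phi; split.
  by move=> x /(face_sub fr)/phi_ge0.
apply/seteqP; split=> x.
  by move=> tx; move: (tx); rewrite {1}tauE => -[_ ?]; split=> //; exact: tr.
by rewrite tauE => -[/(face_sub fr)].
Qed.

Lemma on_face_sub A tau : on_face A tau `<=` A.
Proof. by move=> a []. Qed.

Lemma cone_gen A a : A a -> cone A (of_int R a).
Proof.
move=> Aa; exists [:: a], (fun=> 1); split=> [c | c |]; rewrite ?ler01 //.
  by rewrite inE => /eqP ->.
by rewrite big_seq1 scale1r.
Qed.

(** In a conic combination lying on the face, the exposing form kills every term
    with a nonzero coefficient, its values on the generators being
    nonnegative. *)
Lemma face_generators A tau x : face (cone A) tau -> tau x ->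
  cone (on_face A tau) x.
Proof.
move=> [phi [phi_ge0 ->]] [[s [c [As c_ge0 xE]]] phix].
have terms_ge0 a : a \in s -> 0 <= c a * phi (of_int R a).
  by move=> /As/cone_gen/phi_ge0; apply: mulr_ge0.
have phi_c a : a \in s -> phi (of_int R a) != 0 -> c a = 0.
  move=> sa phia; apply/eqP; rewrite -[_ == 0]orbF -(negPf phia) -mulf_eq0.
  have /eqP : \sum_(a <- s) c a * phi (of_int R a) = 0.
    by rewrite -[RHS]phix xE linear_sum; apply: eq_bigr => e _; rewrite linearZ.
  rewrite big_seq psumr_eq0 // => /allP/(_ a sa); by rewrite sa.
exists [seq a <- s | phi (of_int R a) == 0], c; split=> //.
  move=> a; rewrite mem_filter => /andP[/eqP phia /As Aa]; split=> //.
  by split=> //; exact: cone_gen.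
rewrite big_filter xE [RHS]big_mkcond big_seq [RHS]big_seq.
by apply: eq_bigr => a sa; case: ifPn => // /(phi_c a sa) ->; rewrite scale0r.
Qed.

Lemma face_eq_cone A tau : face (cone A) tau -> tau = cone (on_face A tau).
Proof.
move=> ft; apply/seteqP; split=> x; first exact: face_generators.
have [phi [phi_ge0 tauE]] := ft.
move=> [s [c [As c_ge0 xE]]]; rewrite tauE; split.
  by exists s, c; split=> // a /As[].
rewrite xE linear_sum big_seq big1 //= => a /As[_]; rewrite tauE => -[_ phia].
by rewrite linearZ /= phia mulr0.
Qed.

(** A face is the cone over the generators it contains, so there are at most as
    many faces as subsets of [A]. *)
Lemma finite_faces A :
  finite_set A -> finite_set [set rho | face (@cone R d A) rho].
Proof.
move=> /finite_seqP[s ->].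
pose g (t : (size s).-tuple bool) := @cone R d [set` mask t s].
apply: (@sub_finite_set _ _ (g @` setT)); last exact/finite_image/finite_finset.
move=> rho /= frho; pose p := fun a : 'rV[int]_d => `[< rho (of_int R a) >].
exists (map_tuple p (in_tuple s)) => //; rewrite /g /= -filter_mask.
rewrite [RHS](face_eq_cone frho); congr cone; apply/seteqP; split=> a /=.
  by rewrite mem_filter => /andP[/asboolP ra sa].
by move=> [sa ra]; rewrite mem_filter sa andbT; apply/asboolP.
Qed.

Lemma scalar_Nspan_ge0 A (phi : {scalar 'rV[R]_d}) z :
  (forall a, A a -> 0 <= phi (of_int R a)) ->
  Nspan A z -> 0 <= phi (of_int R z).
Proof.
move=> phi_ge0 [s As ->]; rewrite of_int_sum linear_sum big_seq.
apply: sumr_ge0 => a sa; exact/phi_ge0/As.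
Qed.

Lemma scalar_Zspan_eq0 A (phi : {scalar 'rV[R]_d}) z :
  (forall a, A a -> phi (of_int R a) = 0) -> Zspan A z -> phi (of_int R z) = 0.
Proof.
move=> phi0; have N0 y : Nspan A y -> phi (of_int R y) = 0.
  move=> [s As ->]; rewrite of_int_sum linear_sum big_seq.
  by rewrite big1 // => a /As/phi0.
by move=> [p /N0 p0 [q /N0 q0 <-]]; rewrite of_intB linearB /= p0 q0 subr0.
Qed.

Lemma fin_generated_bounded A S (phi : {scalar 'rV[R]_d}) :
  (forall x, cone A x -> 0 <= phi x) -> fin_generated A S ->
  exists M, forall x, S x -> M <= phi (of_int R x).
Proof.
move=> phi_ge0 [G /finite_seqP[r ->] ->].
exists (- \sum_(g <- r) `|phi (of_int R g)|) => _ [g rg [z Az <-]].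
rewrite of_intD linearD /= -[leLHS]addr0 lerD //; last first.
  by apply: scalar_Nspan_ge0 Az => a /cone_gen/phi_ge0.
rewrite lerNl (big_rem g) //= (le_trans (ler_norm _)) // normrN lerDl.
exact: sumr_ge0.
Qed.

(** A form exposing [rho] is bounded below on [S + Z(A cap rho)]; it is positive
    on some generator of [tau], as [tau] is not contained in [rho], so
    subtracting a large multiple of that generator leaves the localization. *)
Lemma escape_localization A S T tau rho (y : 'rV[int]_d) :
  fin_generated A T -> S `<=` T ->
  face (cone A) tau -> face (cone A) rho -> ~ (tau `<=` rho) ->
  exists2 z, Nspan (on_face A tau) z &
    ~ minkowski S (Zspan (on_face A rho)) (y - z).
Proof.
move=> fgT ST ft [phi [phi_ge0 rhoE]] ntr.
have [a Ata phia] : exists2 a, on_face A tau a & 0 < phi (of_int R a).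
  apply: contra_notP ntr => no_a x tx; rewrite rhoE.
  split; first exact: face_sub tx.
  have [s [c [Bs _ ->]]] := face_generators ft tx.
  rewrite linear_sum big_seq big1 //= => a /Bs Ba; rewrite linearZ /=.
  suff -> : phi (of_int R a) = 0 by rewrite mulr0.
  apply/eqP; rewrite eq_le phi_ge0 ?andbT; last by case: Ba => /cone_gen.
  by rewrite leNgt; apply/negP => phia; apply: no_a; exists a.
have [M S_ge] := fin_generated_bounded phi_ge0 fgT.
pose n := (Num.truncn (`|phi (of_int R y) - M| / phi (of_int R a))).+1.
exists (a *+ n); first exact: NspanMn.
move=> [s Ss [w Bw /(congr1 (fun u => phi (of_int R u)))]].
have w0 : phi (of_int R w) = 0.
  apply: scalar_Zspan_eq0 Bw => e [_]; rewrite rhoE; by case.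
move=> /=; rewrite (of_intD _ s w) (of_intB _ y) linearD linearB /= w0 addr0.
move=> sE.
have anE : phi (of_int R (a *+ n)) = phi (of_int R a) *+ n.
  by rewrite /of_int (raddfMn (@map_mx _ _ (intr : int -> R) 1 d)) raddfMn.
have := S_ge _ (ST _ Ss); rewrite sE anE lerBrDr -lerBrDl leNgt; apply/negP.
rewrite negbK (le_lt_trans (ler_norm _)) // -mulr_natl -ltr_pdivrMr //.
exact: truncnS_gt.
Qed.

End Faces.

(** * Differential operators acting on monomials *)

Section Operators.
Variables (K : fieldType) (d : nat).
Local Notation Laurent := {malg K['rV[int]_d]}.
Implicit Types (a c : 'rV[int]_d) (f : mpoly d K) (P Q : Laurent -> Laurent).

Definition subst_affine (e : int) a f : mpoly d K :=
  f \mPo [tuple e%:~R *: 'X_i + (a 0 i)%:~R%:MP | i < d].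

Lemma at_lattice_subst e a f c :
  at_lattice (subst_affine e a f) c = at_lattice f (e *: c + a).
Proof.
rewrite /at_lattice /subst_affine comp_mpoly_meval; apply: meval_eq => i.
rewrite tnth_mktuple mevalD mevalZ mevalXU mevalC !mxE.
by rewrite intrD intrM.
Qed.

Lemma lin_extend_linear (u : 'rV[int]_d -> Laurent) : linear (lin_extend u).
Proof.
have widen (D : {fset 'rV[int]_d}) p : (monalg.msupp p `<=` D)%fset ->
    lin_extend u p = \sum_(a <- D) monalg.mcoeff a p *: u a.
  move=> sub; rewrite /lin_extend.
  apply: (big_fset_incl _ sub) => a _ /monalg.mcoeff_outdom ->.
  by rewrite scale0r.
move=> k p q.
pose D :=
  (monalg.msupp (k *: p + q) `|` (monalg.msupp p `|` monalg.msupp q))%fset.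
have subU : (monalg.msupp p `|` monalg.msupp q `<=` D)%fset.
  exact: fsubsetUr.
rewrite (widen D (k *: p + q)) ?fsubsetUl //.
rewrite (widen D p) ?(fsubset_trans (fsubsetUl _ _) subU) //.
rewrite (widen D q) ?(fsubset_trans (fsubsetUr _ _) subU) //.
rewrite scaler_sumr -big_split /=; apply: eq_bigr => a _.
by rewrite monalg.mcoeffD monalg.mcoeffZ scalerDl scalerA.
Qed.

Lemma lin_extend_monomial (u : 'rV[int]_d -> Laurent) c :
  lin_extend u << c >> = u c.
Proof.
rewrite /lin_extend monalg.msuppU oner_eq0 big_seq_fset1.
by rewrite monalg.mcoeffUU scale1r.
Qed.

Lemma monomialE (k : K) c : << k *g c >> = k *: << c >> :> Laurent.
Proof.
apply/monalg.malgP => b; rewrite monalg.mcoeffZ.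
transitivity (k *+ (c == b)); first exact: monalg.mcoeffU.
transitivity (k * (1 *+ (c == b))); first by rewrite mulrnAr mulr1.
by congr (_ * _); exact/esym/monalg.mcoeffU.
Qed.

Lemma linear_combination P (I : Type) (r : seq I) (k : I -> K)
    (u : I -> Laurent) :
  linear P -> P (\sum_(i <- r) k i *: u i) = \sum_(i <- r) k i *: P (u i).
Proof.
move=> linP; pose linL := GRing.isLinear.Build K Laurent Laurent *:%R P linP.
pose L : {linear Laurent -> Laurent} := HB.pack P linL.
rewrite -[P]/(L : _ -> _) linear_sum; apply: eq_bigr => i _.
exact: linearZ.
Qed.

Lemma laurent_expansion (p : Laurent) :
  p = \sum_(a <- monalg.msupp p) monalg.mcoeff a p *: << a >>.
Proof.
by rewrite {1}(monalg.monalgE p); apply: eq_bigr => a _; exact: monomialE.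
Qed.

Lemma linear_on_monomials P Q : linear P -> linear Q ->
  (forall c, P << c >> = Q << c >>) -> P = Q.
Proof.
move=> linP linQ PQ; apply: funext => p.
rewrite (laurent_expansion p) (linear_combination _ _ _ linP).
rewrite (linear_combination _ _ _ linQ).
by apply: eq_bigr => a _; rewrite PQ.
Qed.

Lemma linear_scale P :
  linear P -> forall (k : K) (p : Laurent), P (k *: p) = k *: P p.
Proof. exact: GRing.scalable_linear. Qed.

Lemma comp_linear P Q : linear P -> linear Q -> linear (P \o Q).
Proof. by move=> linP linQ k p q /=; rewrite linQ linP. Qed.

Lemma scale_linear (k : K) P : linear P -> linear (fun p => k *: P p).
Proof. by move=> linP l p q; rewrite linP scalerDr !scalerA mulrC. Qed.

Lemma diff_op_linear P : diff_op P -> linear P.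
Proof.
elim=> [a | i | k {}P _ linP | {}P Q _ linP _ linQ | {}P Q _ linP _ linQ].
- exact: lin_extend_linear.
- exact: lin_extend_linear.
- exact: scale_linear.
- by move=> l p q; rewrite linP linQ scalerDr addrACA.
- exact: comp_linear.
Qed.

Lemma tmul_linear a : linear (tmul (K := K) a).
Proof. exact: lin_extend_linear. Qed.

Lemma tmul_monomial a c : tmul (K := K) a << c >> = << a + c >>.
Proof. exact: lin_extend_monomial. Qed.

Lemma partial_monomial i c :
  partial (K := K) i << c >> = << (c 0 i)%:~R *g c - delta_mx 0 i >>.
Proof. exact: lin_extend_monomial. Qed.

Lemma diff_op_id : diff_op (@id Laurent).
Proof.
rewrite (_ : id = tmul 0); first exact: diff_op_tmul.
apply: linear_on_monomials => [//||c]; first exact: lin_extend_linear.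
by rewrite tmul_monomial add0r.
Qed.

Lemma diff_op_sum (I : Type) (r : seq I) (P : I -> Laurent -> Laurent) :
  (forall i, diff_op (P i)) -> diff_op (fun p => \sum_(i <- r) P i p).
Proof.
move=> opP; elim: r => [|i r IHr].
  rewrite (_ : (fun p => _) =
      (fun p => (0 : K) *: (id : Laurent -> Laurent) p)).
    exact/diff_op_scale/diff_op_id.
  by apply: funext => p; rewrite big_nil scale0r.
rewrite (_ : (fun p => _) = (fun p => P i p + \sum_(j <- r) P j p)).
  exact: diff_op_add.
by apply: funext => p; rewrite big_cons.
Qed.

Lemma mpoly_op_diff_op (theta : 'I_d -> Laurent -> Laurent) f :
  (forall i, diff_op (theta i)) -> diff_op (mpoly_op theta f).
Proof.
move=> opt; apply: diff_op_sum => k; apply: diff_op_scale.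
elim/big_ind: _ => [|P Q|i _]; [exact: diff_op_id | exact: diff_op_comp |].
elim: (k i) => [|n IHn]; first exact: diff_op_id.
exact: (diff_op_comp (opt i) IHn).
Qed.

Lemma mpoly_op_eigen (theta : 'I_d -> Laurent -> Laurent) f (v : 'I_d -> K) c :
  (forall i, linear (theta i)) ->
  (forall i, theta i << c >> = v i *: << c >>) ->
  mpoly_op theta f << c >> = f.@[v] *: << c >>.
Proof.
move=> lint eig; rewrite /mpoly_op mevalE scaler_suml; apply: eq_bigr => k _.
rewrite -scalerA; apply: (congr1 (fun p : Laurent => f@_k *: p)).
elim/big_rec2: _ => [|i P y _ IHP]; first by rewrite scale1r.
rewrite /= IHP; elim: (k i) => [|n IHn]; first by rewrite mul1r.
rewrite iterS IHn (linear_scale (lint i)) eig scalerA.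
have -> : v i ^+ n.+1 * y = v i ^+ n * y * v i by rewrite exprSr mulrAC.
reflexivity.
Qed.

Lemma euler_monomial i c : euler (K := K) i << c >> = (c 0 i)%:~R *: << c >>.
Proof.
rewrite /euler /= partial_monomial monomialE.
rewrite (linear_scale (tmul_linear _)) tmul_monomial.
by rewrite addrCA subrr addr0.
Qed.

Lemma euler_diff_op i : diff_op (euler (K := K) (d := d) i).
Proof. exact: diff_op_comp (diff_op_tmul _ _) (diff_op_partial _ _). Qed.

Lemma opp_euler_diff_op i : diff_op (fun p => - euler (K := K) (d := d) i p).
Proof.
rewrite (_ : (fun p => _) = (fun p => (-1 : K) *: euler i p)).
  exact/diff_op_scale/euler_diff_op.
by apply: funext => p; rewrite scaleN1r.
Qed.

Lemma mpoly_op_euler f c :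
  mpoly_op (@euler K d) f << c >> = at_lattice f c *: << c >>.
Proof.
apply: mpoly_op_eigen => i; last exact: euler_monomial.
exact/diff_op_linear/euler_diff_op.
Qed.

Lemma mpoly_op_opp_euler f c :
  mpoly_op (fun i q => - euler i q) f << c >> = at_lattice f (- c) *: << c >>.
Proof.
apply: mpoly_op_eigen => i; first exact/diff_op_linear/opp_euler_diff_op.
by rewrite euler_monomial mxE intrN scaleNr.
Qed.

(** * Normal forms, formal adjoints and exit sets *)

(** [left_form E g] and [right_form E g] are an operator and its formal
    adjoint. *)
Definition left_form (E : {fset 'rV[int]_d}) (g : 'rV[int]_d -> mpoly d K) :
    Laurent -> Laurent :=
  fun p => \sum_(a <- E) tmul a (mpoly_op (@euler K d) (g a) p).

Definition right_form (E : {fset 'rV[int]_d}) (g : 'rV[int]_d -> mpoly d K) :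
    Laurent -> Laurent :=
  fun p => \sum_(a <- E) mpoly_op (fun i q => - euler i q) (g a) (tmul a p).

Lemma left_form_diff_op E g : diff_op (left_form E g).
Proof.
apply: (@diff_op_sum _ E) => a; apply: (diff_op_comp (diff_op_tmul _ a)).
by apply: mpoly_op_diff_op => i; exact: euler_diff_op.
Qed.

Lemma right_form_diff_op E g : diff_op (right_form E g).
Proof.
apply: (@diff_op_sum _ E) => a.
apply: (fun h => diff_op_comp h (diff_op_tmul _ a)).
by apply: mpoly_op_diff_op => i; exact: opp_euler_diff_op.
Qed.

Lemma left_form_monomial E g c :
  left_form E g << c >> = \sum_(a <- E) at_lattice (g a) c *: << a + c >>.
Proof.
apply: eq_bigr => a _; rewrite mpoly_op_euler.
by rewrite (linear_scale (tmul_linear a)) tmul_monomial.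
Qed.

Lemma right_form_monomial E g c :
  right_form E g << c >> =
  \sum_(a <- E) at_lattice (g a) (- (a + c)) *: << a + c >>.
Proof. by apply: eq_bigr => a _; rewrite tmul_monomial mpoly_op_opp_euler. Qed.

(** The shifts [t.1] may repeat here, which makes this form stable under sums
    and compositions. *)
Lemma diff_op_symbol P : diff_op P ->
  exists s : seq ('rV[int]_d * mpoly d K),
    forall c, P << c >> = \sum_(t <- s) at_lattice t.2 c *: << t.1 + c >>.
Proof.
elim=> [a | i | k {}P _ [s Ps] | {}P Q _ [s Ps] _ [s' Qs']
       | {}P Q opP [s Ps] _ [s' Qs']].
- exists [:: (a, 1)] => c; rewrite tmul_monomial big_seq1 /at_lattice.
  by rewrite meval1 scale1r.
- exists [:: (- delta_mx 0 i, 'X_i)] => c.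
  by rewrite partial_monomial monomialE big_seq1 /at_lattice mevalXU addrC.
- exists [seq (t.1, k *: t.2) | t <- s] => c; rewrite Ps big_map scaler_sumr.
  by apply: eq_bigr => t _; rewrite /at_lattice mevalZ scalerA.
- by exists (s ++ s') => c; rewrite Ps Qs' big_cat.
- exists [seq (t.1 + t'.1, t'.2 * subst_affine 1 t'.1 t.2) | t' <- s', t <- s].
  move=> c; rewrite big_allpairs_dep /= Qs'.
  have -> : P (\sum_(t' <- s') at_lattice t'.2 c *: << t'.1 + c >>) =
      \sum_(t' <- s') at_lattice t'.2 c *: P << t'.1 + c >>.
    exact/linear_combination/diff_op_linear.
  apply: eq_bigr => t' _; rewrite Ps scaler_sumr; apply: eq_bigr => t _.
  rewrite scalerA /= {3}/at_lattice mevalM.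
  rewrite -/(at_lattice _ _) -/(at_lattice _ _) at_lattice_subst scale1r.
  by rewrite (addrC c) addrA.
Qed.

(** The value of the coefficient at [a] is read at [-(a + c)] in a right form
    and at [c] in the expansion above, whence the substitution
    [y |-> - y - a]. *)
Lemma diff_op_right_form P : diff_op P -> exists E g, P = right_form E g.
Proof.
move=> opP; have [s Ps] := diff_op_symbol opP.
exists [fset t | t in unzip1 s]%fset.
exists (fun a => \sum_(t <- s | t.1 == a) subst_affine (-1) (- a) t.2).
apply: linear_on_monomials => [||c]; first exact: diff_op_linear.
  exact/diff_op_linear/right_form_diff_op.
rewrite Ps right_form_monomial.
transitivity (\sum_(a <- [fset t | t in unzip1 s]%fset)
    \sum_(t <- s | t.1 == a) at_lattice t.2 c *: << t.1 + c >>); last first.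
  apply: eq_bigr => a _; rewrite /at_lattice rmorph_sum scaler_suml /=.
  apply: eq_bigr => t /eqP <-; rewrite -!/(at_lattice _ _) at_lattice_subst.
  by rewrite scaleN1r opprK addrAC subrr add0r.
symmetry; apply: (@sum_by_key _ _ _ fst); first exact: fset_uniq.
by move=> a; rewrite in_fset.
Qed.

Definition preserves (T : set 'rV[int]_d) P :=
  forall p, supported_in T p -> supported_in T (P p).

Lemma mcoeff_shifted_sum (E : {fset 'rV[int]_d}) (k : 'rV[int]_d -> K) c e :
  monalg.mcoeff e (\sum_(a <- E) k a *: << a + c >> : Laurent) =
  if e - c \in E then k (e - c) else 0.
Proof.
rewrite raddf_sum /=.
transitivity (\sum_(a <- E | a == e - c) k a).
  rewrite [RHS]big_mkcond /=; apply: eq_bigr => a _.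
  transitivity (k a * (1 *+ (a + c == e))).
    apply: etrans (monalg.mcoeffZ _ _ _) _.
    by apply: (congr1 (fun x => k a * x)); exact: monalg.mcoeffU.
  by rewrite eq_sym -subr_eq eq_sym; case: ifP; rewrite ?mulr1 ?mulr0.
case: ifPn => [ecE | ecE].
  by rewrite -big_filter filter_pred1_uniq ?fset_uniq ?big_seq1.
rewrite big_seq_cond big1 // => a /andP[aE /eqP ea].
by rewrite -ea aE in ecE.
Qed.

(** The shifts [a] in [E] being distinct, the terms of [P t^c] cannot cancel. *)
Lemma preservesP P (E : {fset 'rV[int]_d})
    (phi : 'rV[int]_d -> 'rV[int]_d -> K) T :
  linear P ->
  (forall c, P << c >> = \sum_(a <- E) phi a c *: << a + c >>) ->
  preserves T P <-> (forall a c, a \in E -> T c -> ~ T (a + c) -> phi a c = 0).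
Proof.
move=> linP PE; split=> [PT a c aE Tc nTac | phi0 p pT e].
  have /PT : supported_in T (<< c >> : Laurent).
    by move=> e; rewrite monalg.msuppU oner_eq0 => /fset1P ->.
  move=> /(_ (a + c)) sup; apply/eqP/negPn/negP => phi_n0.
  apply: nTac; apply: sup.
  by rewrite -monalg.mcoeff_neq0 PE mcoeff_shifted_sum addrK aE.
rewrite -monalg.mcoeff_neq0 => /eqP Pp; apply: contrapT => nTe; apply: Pp.
rewrite (laurent_expansion p) (linear_combination _ _ _ linP).
rewrite raddf_sum big_seq big1 //= => c cp.
apply: etrans (monalg.mcoeffZ _ _ _) _.
rewrite PE mcoeff_shifted_sum; case: ifPn => [ecE|]; last by rewrite mulr0.
by rewrite (phi0 _ _ ecE (pT _ cp)) ?mulr0 // subrK.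
Qed.

(** Both algebras are described by vanishing of the coefficients on exit sets:
    for the adjoint the coefficient at [a] is read at [-(a + c)], so that the
    exit set of [T] turns into that of the complement of [-T]. *)
Lemma diff_ops_eq_adjoints (S T : set 'rV[int]_d) :
  (forall f a,
     (forall c, S c -> ~ S (a + c) -> at_lattice f c = 0) <->
     (forall c, ~ T (- c) -> T (- (a + c)) -> at_lattice f c = 0)) ->
  diff_ops K T = adjoints (diff_ops K S).
Proof.
move=> ST.
have stable E g : preserves S (left_form E g) <-> preserves T (right_form E g).
  rewrite (preservesP _ (diff_op_linear (left_form_diff_op E g))
             (left_form_monomial E g)).
  rewrite (preservesP _ (diff_op_linear (right_form_diff_op E g))
             (right_form_monomial E g)).
  split=> g0 a c aE.
    move=> Tc nTac; apply: (ST (g a) a).1; rewrite ?opprK //.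
      by move=> x; exact: g0.
    by rewrite opprD opprK addKr.
  apply: (ST (g a) a).2 c => x nTx Tax.
  have := g0 a (- (a + x)) aE Tax.
  by rewrite !opprD !opprK !addKr addrA subrr sub0r; exact.
apply/seteqP; split=> [Q [opQ QT] | Q [P [opP PS] [E [g [PE QE]]]]].
  have [E [g QE]] := diff_op_right_form opQ.
  exists (left_form E g); last by exists E, g.
  split; first exact: left_form_diff_op.
  by apply/stable; rewrite -QE.
split; first by rewrite QE; exact: right_form_diff_op.
by rewrite QE; apply/stable; rewrite /left_form -PE.
Qed.

End Operators.

(** * Exit sets of [S] and of the complement of [-omega(S)] *)

Ltac entrywise := apply/rowP => ?; rewrite !mxE; ring.

(** Write [x = beta + s + p - q] with [p], [q] in [N(B)].  The points of
    [s + p + N(B)] lie in [S] and leave it under [a], since otherwise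
    [a + x - beta] would stay in the localization; and [x] differs from
    [s + p] by [beta - q], which lies in the span of [B]. *)
Lemma vanish_on_localization (K : fieldType) (d : nat) (f : mpoly d K)
    (A B S : set 'rV[int]_d) (beta a x : 'rV[int]_d) :
  [pchar K] =i pred0 -> NA_set A S -> B `<=` A ->
  Lspan K B (of_int K beta) ->
  (forall c, S c -> ~ S (a + c) -> at_lattice f c = 0) ->
  minkowski S (Zspan B) (x - beta) -> ~ minkowski S (Zspan B) (a + x - beta) ->
  at_lattice f x = 0.
Proof.
move=> charK0 NAS BA Kbeta f0 [s Ss [_ [p Bp [q Bq <-]] xE]] outW.
have {}xE : x = s + (p - q) + beta by rewrite xE subrK.
apply: (vanish_Lspan charK0 (B := B) (y := s + p) (k := 1)).
- exact: oner_neq0.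
- move=> z Bz; rewrite scale1r; apply: f0.
    apply: (NA_setD NAS); last exact: Nspan_sub BA Bz.
    exact: (NA_setD NAS) Ss (Nspan_sub BA Bp).
  move=> Sout; apply: outW; exists (a + (s + p + z)) => //.
  exists (- (q + z)); first exact/ZspanN/NspanD.
  by rewrite xE; entrywise.
- have -> : x - (s + p) = beta - q.
    by rewrite xE; entrywise.
  by rewrite of_intB; apply: LspanB => //; exact: Lspan_Nspan.
Qed.

Section Duality.
Variables (R : realType) (d m : nat) (A Sc S : set 'rV[int]_d).
Variables (F : set 'rV[R]_d -> {scalar 'rV[R]_d}).
Variables (b : 'I_m -> 'rV[int]_d) (tau : 'I_m -> set 'rV[R]_d).
Variables (K : fieldType) (beta : set 'rV[R]_d -> 'rV[int]_d).
Hypothesis charK0 : [pchar K] =i pred0.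
Hypothesis finA : finite_set A.
Hypothesis ZA : Zspan A = [set: 'rV[int]_d].
Hypothesis primF : forall sigma, facet (cone A) sigma ->
  primitive_form (cone A) sigma (F sigma).
Hypothesis Sc_fg : fin_generated A Sc.
Hypothesis Sc_scored : scored A F Sc.
Hypothesis tau_face : forall i, face (cone A) (tau i).
Hypothesis S_def : S = Sc `\` \bigcup_(i in [set: 'I_m])
  translate (b i) (Zspan (on_face A (tau i))).
Hypothesis F_S : forall sigma, facet (cone A) sigma ->
  lattice_values (F sigma) S = lattice_values (F sigma) Sc.
Hypothesis S_NA : NA_set A S.
Hypothesis beta_B : compatible_family A b tau K beta.

(** The complement of [-omega(S)], see [omegaE]. *)
Definition opp_omega_compl : set 'rV[int]_d :=
  [set x | exists2 rho, facets_and_taus A tau rho &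
     minkowski S (Zspan (on_face A rho)) (x - beta rho)].

Lemma facets_and_taus_face rho : facets_and_taus A tau rho -> face (cone A) rho.
Proof. by move=> [[] // | [i <-]]. Qed.

Lemma S_sub_Sc : S `<=` Sc.
Proof. by rewrite S_def => c []. Qed.

Lemma notin_translate i x :
  S x -> ~ translate (b i) (Zspan (on_face A (tau i))) x.
Proof. by rewrite S_def => -[_ nUx] tx; apply: nUx; exists i. Qed.

(** If [tau i] is contained in [rho], compatibility moves [b i + beta (tau i)]
    to [b j + beta rho] with [tau j = rho], so membership in the localization
    at [rho] would put a point of [S] into the removed class of [b j]. *)
Lemma exit_along_tau i c a rho :
  translate (b i) (Zspan (on_face A (tau i))) (a + c) ->
  facets_and_taus A tau rho ->
  exists2 z, Nspan (on_face A (tau i)) z &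
    ~ minkowski S (Zspan (on_face A rho)) (a + c + beta (tau i) - beta rho - z).
Proof.
move=> [w Bw acE] Frho; have frho := facets_and_taus_face Frho.
have [tr | ntr] := pselect (tau i `<=` rho); last first.
  exact: escape_localization Sc_fg S_sub_Sc (tau_face i) frho ntr.
exists 0; first exact: Nspan0.
rewrite subr0 => -[s Ss [v Bv sE]].
have [j [jrho]] := beta_B.2 i rho Frho (face_of_subface (tau_face i) frho tr).
rewrite jrho => bE.
apply: (@notin_translate j s Ss); rewrite jrho.
exists (b i + beta (tau i) - (b j + beta rho) + (w - v)); last first.
  by rewrite -(addrK v s) sE -acE; entrywise.
apply: ZspanD => //; apply: ZspanB => //; apply: Zspan_sub Bw.
by move=> e [Ae te]; split=> //; exact: tr.
Qed.

(** The only faces containing [sigma] are [sigma] and the whole cone.  At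
    [sigma] the value of [F sigma] decides; the cone cannot occur among the
    [tau i], as removing a class of [Z(A)], the whole lattice, would make
    [S] empty. *)
Lemma exit_along_facet sigma c a rho :
  facet (cone A) sigma -> S c ->
  ~ lattice_values (F sigma) Sc (F sigma (of_int R (a + c))) ->
  facets_and_taus A tau rho ->
  exists2 z, Nspan (on_face A sigma) z &
    ~ minkowski S (Zspan (on_face A rho)) (a + c + beta sigma - beta rho - z).
Proof.
move=> facet_s c_in_S out Frho; have frho := facets_and_taus_face Frho.
have [fs sneC smax] := facet_s.
have [sr | nsr] := pselect (sigma `<=` rho); last first.
  exact: escape_localization Sc_fg S_sub_Sc fs frho nsr.
exists 0; first exact: Nspan0.
rewrite subr0; have [-> | rC] := smax _ frho sr.
  rewrite addrK => -[s Ss [v Bv sE]]; apply: out; rewrite -F_S //.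
  exists s => //; rewrite -sE of_intD linearD /=.
  rewrite (scalar_Zspan_eq0 _ Bv) ?addr0 // => e [_].
  by have [_ F0 _] := primF facet_s; exact: F0.
case: Frho => [[_ neC _] | [i tauE]]; first by case: (neC rC).
exfalso; apply: (@notin_translate i c c_in_S).
exists (c - b i); last by rewrite addrC subrK.
suff -> : on_face A (tau i) = A by rewrite ZA.
rewrite tauE rC; apply/seteqP; split=> e; first by case.
by move=> Ae; split=> //; exact: cone_gen.
Qed.

(** The way [a + c] fails to be in [S] selects [sigma]: a violated facet value,
    or a removed class along some [tau i]. *)
Lemma exit_face c a : S c -> ~ S (a + c) ->
  exists2 sigma, facets_and_taus A tau sigma &
    forall rho, facets_and_taus A tau rho ->
    exists2 z, Nspan (on_face A sigma) z &
      ~ minkowski S (Zspan (on_face A rho)) (a + c + beta sigma - beta rho - z).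
Proof.
move=> c_in_S nSac; have [Sc_ac | nSc_ac] := pselect (Sc (a + c)).
  have [i t_ac] : exists i, translate (b i) (Zspan (on_face A (tau i))) (a + c).
    apply: contrapT => no_i; apply: nSac; rewrite S_def; split=> // -[i _ ti].
    by apply: no_i; exists i.
  by exists (tau i) => [|rho]; [right; exists i | exact: exit_along_tau].
have [sigma fs out] : exists2 sigma, facet (cone A) sigma &
    ~ lattice_values (F sigma) Sc (F sigma (of_int R (a + c))).
  apply: contrapT => no_s; apply: nSc_ac; rewrite Sc_scored => sigma fs.
  by apply: contrapT => out; apply: no_s; exists sigma.
by exists sigma => [|rho]; [left | exact: exit_along_facet].
Qed.

Lemma vanish_exit_sets (f : mpoly d K) a :
  (forall c, S c -> ~ S (a + c) -> at_lattice f c = 0) <->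
  (forall c, opp_omega_compl c -> ~ opp_omega_compl (a + c) ->
     at_lattice f c = 0).
Proof.
split=> f0 c.
  move=> [rho Frho Sx] nWac.
  apply: (vanish_on_localization charK0 S_NA (@on_face_sub _ _ A rho)
            (beta_B.1 rho Frho) f0 Sx).
  by move=> Sac; apply: nWac; exists rho.
move=> c_in_S nSac; have [sigma Fs exits] := exit_face c_in_S nSac.
have finF : finite_set (facets_and_taus A tau).
  exact: sub_finite_set facets_and_taus_face (finite_faces R finA).
have BA := @on_face_sub _ _ A sigma.
have NA_W rho :
    NA_set A [set x | minkowski S (Zspan (on_face A rho)) (x - beta rho)].
  move=> _ [x Wx [z Az <-]] /=; rewrite addrAC.
  exact: NA_setD (NA_set_localization S_NA) Wx Az.
have [|z0 Bz0 outW] := uniform_shift (y := a + c + beta sigma) finF BA NA_W.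
  by move=> rho /exits[z Bz out]; exists z => //=; rewrite addrAC.
(* Subtracting more of [N(A cap sigma)] than [z0] keeps the shifted point
   outside, so [f] vanishes on [c + beta sigma - z0 - N(A cap sigma)]. *)
apply: (vanish_Lspan charK0 (B := on_face A sigma)
          (y := c + beta sigma - z0) (k := -1)).
- by rewrite mulrN1z oppr_eq0 oner_neq0.
- move=> z Bz; rewrite scaleN1r; apply: f0.
    exists sigma => //; exists c => //; exists (- (z0 + z)).
      exact/ZspanN/NspanD.
    by entrywise.
  move=> [rho Frho Wout]; apply: (outW rho Frho) => /=.
  have := NA_setD (NA_set_localization S_NA) Wout (Nspan_sub BA Bz).
  rewrite (_ : _ + z = a + c + beta sigma - z0 - beta rho) //.
  by entrywise.
- have -> : c - (c + beta sigma - z0) = z0 - beta sigma by entrywise.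
  by rewrite of_intB; apply: LspanB; [exact: Lspan_Nspan | exact: beta_B.1].
Qed.

Lemma omegaE c : omega A tau beta S c <-> ~ opp_omega_compl (- c).
Proof.
split=> [om [rho Frho Sx] | nW rho Frho Sx]; first exact: (om rho).
by apply: nW; exists rho.
Qed.

End Duality.

Theorem theorem6p10
  (R : realType) (K : closedFieldType) (charK0 : [pchar K] =i pred0)
  (d : nat) (A : set 'rV[int]_d)
  (finA : finite_set A)
  (ZA : Zspan A = [set: 'rV[int]_d])
  (coneA : strongly_convex (@cone R d A))
  (F : set 'rV[R]_d -> {scalar 'rV[R]_d})
  (primF : forall sigma, facet (cone A) sigma ->
             primitive_form (cone A) sigma (F sigma))
  (m : nat) (Sc S : set 'rV[int]_d)
  (b : 'I_m -> 'rV[int]_d) (tau : 'I_m -> set 'rV[R]_d)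
  (Sc_NA : NA_set A Sc)
  (Sc_fg : fin_generated A Sc)
  (Sc_scored : scored A F Sc)
  (b_Sc : forall i, Sc (b i))
  (tau_face : forall i, face (cone A) (tau i))
  (S_def : S = Sc `\` \bigcup_(i in [set: 'I_m])
                        translate (b i) (Zspan (on_face A (tau i))))
  (S_irredundant : forall i0 : 'I_m,
     S <> Sc `\` \bigcup_(i in [set i | i != i0])
                   translate (b i) (Zspan (on_face A (tau i))))
  (F_S : forall sigma, facet (cone A) sigma ->
           lattice_values (F sigma) S = lattice_values (F sigma) Sc)
  (S_NA : NA_set A S)
  (beta : set 'rV[R]_d -> 'rV[int]_d)
  (beta_B : compatible_family A b tau K beta) :
  diff_ops K (omega A tau beta S) = adjoints (diff_ops K S).
Proof.
apply: diff_ops_eq_adjoints => f a.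
apply: iff_trans (vanish_exit_sets charK0 finA ZA primF Sc_fg Sc_scored tau_face
  S_def F_S S_NA beta_B f a) _.
split=> f0 c.
  move=> /omegaE; rewrite opprK => /contrapT Wc /omegaE; rewrite opprK => nWac.
  exact: f0.
move=> Wc nWac; apply: f0; first by move=> /omegaE; rewrite opprK.
by apply/omegaE; rewrite opprK.
Qed.
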